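(* Let $q$ be a power of a prime $p$. Let $A,B\subseteq \mathbb{F}_q$ be sets such that $|A|=m \geq 2$, $|B|=n \geq 2$, and $mn \leq q$. Then the set of points $A\times B\subseteq AG(2,q)$ determines at least $$mn-\min \{p^{s_1}(n-1),\, p^{s_2}(m-1)\}+1$$ directions, where $s_1$ is the largest integer such that $p^{s_1}n \leq q$ and $s_2$ is the largest integer such that $p^{s_2}m \leq q$.
   Context: $\mathbb{F}_q$ is the finite field with $q$ elements and $AG(2,q)$ is the affine plane over $\mathbb{F}_q$, whose points are identified with $\mathbb{F}_q\times\mathbb{F}_q$ via Cartesian coordinates. For a set of points $U=\{(x_i,y_i): 1\le i\le |U|\}\subseteq AG(2,q)$, the set of directions determined by $U$ is $$\mathcal{D}_U=\left\{\frac{y_j-y_i}{x_j-x_i}: 1\le i<j\le |U|\right\}\subseteq \mathbb{F}_q\cup\{\infty\},$$ where the quotient is $\infty$ (the vertical direction) when $x_i=x_j$. The number of directions determined by $U$ is $|\mathcal{D}_U|$ (so the direction $\infty$ is counted if it occurs). *)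

(* Defs.v *)
From HB Require Import structures.
From mathcomp Require Import all_boot all_order all_algebra.

Set Implicit Arguments.
Unset Strict Implicit.
Unset Printing Implicit Defensive.

Import Order.TTheory GRing.Theory Num.Theory.
Local Open Scope ring_scope.

(* Directions live in F ∪ {∞}, encoded as [option F]; [None] is ∞, the
   vertical direction. *)
Definition direction (F : finFieldType) (u v : F * F) : option F :=
  if u.1 == v.1 then None else Some ((v.2 - u.2) / (v.1 - u.1)).

(* [direction u v = direction v u], so ranging over ordered pairs of distinct
   points gives the same set as ranging over indices i < j. *)
Definition directions (F : finFieldType) (U : {set F * F}) : {set option F} :=
  [set direction u v | u in U, v in U & u != v].

(* Main.v *)
(* Let H(x, y) be the product of the x - (b - a y) over (a, b) in U = A x B, and
   divide x^q = H f + R with deg_x R < |U|.  A weight count gives the coefficient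
   R_j(y) of x^j degree at most q - j.  If the slope y0 is not determined then
   H(x, y0) divides x^q - x, so R(x, y0) = x; thus R_j (j <> 1) vanishes at all
   undetermined slopes.  If D directions are determined, the vertical one among them,
   there are q + 1 - D such slopes, more than q - j when j >= D, so deg_x R < D.

   At y = 0, H is the product of the (x - b)^m over b in B, so g = R(x, 0) satisfies
   (x - b)^m | g - b for all b in B.  Write g = h^(p^t) with h' <> 0.  Then h' is
   divisible by (x - b)^((m-1) / p^t) (integer division) for all b in B, and counting
   degrees gives D >= m n - p^t (n - 1) + 1.  Finally x^(q / p^t) - h vanishes on B
   and deg h < q / p^t, so p^t n <= q, that is t <= s1.  The other bound follows by
   exchanging A and B, which inverts the slopes. *)
Require Import Defs.
From HB Require Import structures.
From mathcomp Require Import all_boot all_order all_algebra all_field.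
From mathcomp Require Import zify ring.

Set Implicit Arguments.
Unset Strict Implicit.
Unset Printing Implicit Defensive.

Import Order.TTheory GRing.Theory Num.Theory.
Local Open Scope ring_scope.

(** * Total degree in x and y, and division of x^e *)

(* [P`_j] is the coefficient of x^j, a polynomial in y.  As [d.+1 - j] truncates,
   the bound says that P(x, y) has total degree at most d. *)
Definition weight_le (F : fieldType) (d : nat) (P : {poly {poly F}}) : Prop :=
  forall j, (size (P`_j)%R <= d.+1 - j)%N.

Lemma size_mul_weight (F : fieldType) (a b i j : nat) (P Q : {poly F}) :
  (size P <= a.+1 - i)%N -> (size Q <= b.+1 - j)%N ->
  (size (P * Q)%R <= (a + b).+1 - (i + j))%N.
Proof.
have [->|P_neq0] := eqVneq P 0; first by rewrite mul0r size_poly0.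
have [->|Q_neq0] := eqVneq Q 0; first by rewrite mulr0 size_poly0.
rewrite size_mul // => leP leQ; move: P_neq0 Q_neq0; rewrite -!size_poly_gt0.
by move: (size P) (size Q) leP leQ => x y; lia.
Qed.

Lemma weight_le_mulXsubC (F : fieldType) d (P : {poly {poly F}}) (c : {poly F}) :
  (size c <= 2)%N -> weight_le d P -> weight_le d.+1 (('X - c%:P) * P).
Proof.
move=> size_c wP j; rewrite mulrBl coefB coefXM coefCM.
apply: leq_trans (size_polyD _ _) _; rewrite size_polyN geq_max.
apply/andP; split; first by case: j => [|j] /=; rewrite ?size_poly0 // wP.
exact: (@size_mul_weight F 1 d 0 j).
Qed.

Lemma weight_le_prodXsubC (F : fieldType) (I : Type) (s : seq I) (c : I -> {poly F}) :
  (forall i, size (c i) <= 2)%N ->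
  weight_le (size s) (\prod_(i <- s) ('X - (c i)%:P)).
Proof.
move=> size_c; elim: s => [|i s IHs]; last first.
  by rewrite big_cons; apply: weight_le_mulXsubC.
by case=> [|j]; rewrite big_nil coef1 /= ?size_poly1 // size_poly0.
Qed.

(** Long division, one power of x at a time: x R is reduced by subtracting H times the top
    coefficient of R. That coefficient has degree at most e - (N - 1) in y, so the product has total
    degree at most e + 1. *)
Lemma weight_le_division (F : fieldType) (H : {poly {poly F}}) (N e : nat) :
  (0 < N)%N -> H \is monic -> size H = N.+1 -> weight_le N H ->
  exists f R, [/\ 'X^e = H * f + R, (size R <= N)%N & weight_le e R].
Proof.
case: N => // N _ monH szH wH; elim: e => [|e [f [R [eqX szR wR]]]].
  exists 0, 1; rewrite mulr0 add0r expr0 size_poly1; split=> //.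
  by case=> [|j]; rewrite coef1 /= ?size_poly1 // size_poly0.
have HN1 : H`_N.+1 = 1 by move/monicP: monH; rewrite /lead_coef szH.
exists (f * 'X + (R`_N)%:P), (R * 'X - H * (R`_N)%:P); split.
- by rewrite exprSr eqX mulrDr mulrDl mulrA addrACA subrr addr0.
- apply/leq_sizeP => j; rewrite leq_eqVlt => /predU1P[<-|Nj].
    by rewrite coefB coefMX coefMC /= HN1 mul1r subrr.
  rewrite coefB coefMX coefMC (gtn_eqF (leq_trans _ Nj)) //.
  rewrite nth_default; last by apply: leq_trans szR _; case: j Nj.
  by rewrite nth_default ?mul0r ?subr0 ?szH.
move=> j; rewrite coefB coefMX coefMC.
apply: leq_trans (size_polyD _ _) _; rewrite size_polyN geq_max.
apply/andP; split; first by case: j => [|j] /=; rewrite ?size_poly0 // wR.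
apply: leq_trans (size_mul_weight (wH j) (wR N)) _; lia.
Qed.

(** * Rédei polynomials and undetermined slopes *)

Section Redei.
Variables (F : finFieldType) (U : {set F * F}).

(* The Rédei polynomial of [U], specialised at the slope [y]: its roots are the
   intercepts of the lines of slope [y] through the points of [U]. *)
Definition redei (y : F) : {poly F} := \prod_(u in U) ('X - (u.2 - u.1 * y)%:P).

(** Points of [U] sharing an intercept at slope [y] would determine [y], so the roots are distinct
    elements of F. *)
Lemma redei_dvd_undetermined y :
  Some y \notin directions U -> redei y %| 'X^#|F| - 'X.
Proof.
move=> Dy; rewrite /redei -big_enum /=.
rewrite -(big_map (fun u => u.2 - u.1 * y) xpredT (fun c => 'X - c%:P)).
apply: uniq_roots_dvdp.
  by apply/allP => c _; rewrite /root !hornerE ?hornerXn expf_card subrr.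
rewrite uniq_rootsE map_inj_in_uniq ?enum_uniq // => u v.
rewrite !mem_enum => Uu Uv eq_uv; apply/eqP/negP => /negP neq_uv.
have eq_y : v.2 - u.2 = y * (v.1 - u.1).
  by rewrite -[v.2](subrK (v.1 * y)) -eq_uv; ring.
case/negP: Dy; apply/imset2P; exists u v => //; first by rewrite inE Uv.
rewrite /direction; case: eqP => [eq1|/eqP neq1].
  case/eqP: neq_uv; move: eq_y; rewrite eq1 subrr mulr0 => /subr0_eq eq2.
  by rewrite [u]surjective_pairing [v]surjective_pairing eq1 eq2.
by rewrite eq_y mulfK // subr_eq0 eq_sym.
Qed.

Lemma redei_remainder_undetermined y :
  (1 < #|U|)%N -> Some y \notin directions U ->
  forall f r, 'X^#|F| = redei y * f + r -> (size r <= #|U|)%N -> r = 'X.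
Proof.
move=> U1 /redei_dvd_undetermined Hdvd f r eqX szr.
apply/eqP; rewrite -subr_eq0; apply: contraLR Hdvd => rX_neq0.
rewrite eqX -addrA dvdp_addr ?dvdp_mulr //; apply: contraNN rX_neq0 => Hdvd.
apply: contraLR Hdvd => rX_neq0; rewrite gtNdvdp //.
rewrite /redei -big_enum size_prod_XsubC -cardE ltnS.
by apply: leq_trans (size_polyD _ _) _; rewrite size_polyN size_polyX geq_max szr.
Qed.

Lemma card_undetermined : None \in directions U ->
  (#|F|.+1 - #|directions U| <= #|[set y | Some y \notin directions U]|)%N.
Proof.
move=> DN; rewrite -card_option -(cardsC (directions U)) addKn.
have Sinj : injective (@Some F) by move=> x y [].
rewrite -(card_imset _ Sinj); apply/subset_leq_card/subsetP => -[y|].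
  by rewrite inE => Dy; apply/imsetP; exists y; rewrite ?inE.
by rewrite inE DN.
Qed.

(** Division takes place over F[y] before specialising, so the degree bound forced by the
    undetermined slopes reaches the determined ones too; slope 0 is the one needed later. *)
Lemma redei_remainder :
  None \in directions U -> (1 < #|directions U|)%N -> (1 < #|U|)%N ->
  forall y, exists f r, 'X^#|F| = redei y * f + r /\ (size r <= #|directions U|)%N.
Proof.
move=> DN D1 U1 y.
pose c (u : F * F) : {poly F} := u.2%:P - u.1 *: 'X.
have size_c u : (size (c u) <= 2)%N.
  apply: leq_trans (size_polyD _ _) _; rewrite size_polyN geq_max.
  rewrite (leq_trans (size_polyC_leq1 _)) //.
  by rewrite (leq_trans (size_scale_leq _ _)) ?size_polyX.
pose H : {poly {poly F}} := \prod_(u <- enum U) ('X - (c u)%:P).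
have evalH z : map_poly (horner_eval z) H = redei z.
  rewrite /H rmorph_prod /redei -big_enum; apply: eq_bigr => u _ /=.
  by rewrite rmorphB /= map_polyX map_polyC /= /horner_eval /c !hornerE.
have [|||| f [R [eqX szR wR]]] := @weight_le_division F H #|U| #|F|.
- exact: ltnW.
- exact: monic_prod_XsubC.
- by rewrite size_prod_XsubC -cardE.
- by rewrite cardE; apply: weight_le_prodXsubC.
have evalX z :
    'X^#|F| = redei z * map_poly (horner_eval z) f + map_poly (horner_eval z) R.
  by rewrite -evalH -rmorphM -rmorphD -eqX /= map_polyXn.
exists (map_poly (horner_eval y) f), (map_poly (horner_eval y) R); split=> //.
apply/leq_sizeP => j Dj; rewrite coef_map.
suff -> : R`_j = 0 by exact: horner0.
apply/eqP/negP => /negP Rj_neq0.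
set V := [set z | Some z \notin directions U].
have Vroot : all (root R`_j) (enum V).
  apply/allP => z; rewrite mem_enum inE => Dz.
  have szRz : (size (map_poly (horner_eval z) R) <= #|U|)%N.
    exact: leq_trans (size_poly _ _) szR.
  have /(congr1 (fun P : {poly F} => P`_j)) :=
    redei_remainder_undetermined U1 Dz (evalX z) szRz.
  by rewrite coef_map coefX /horner_eval gtn_eqF ?(leq_trans D1) // => /eqP.
(* A nonzero coefficient would give |V| < size R_j <= q + 1 - j <= q + 1 - D <= |V|. *)
have := leq_trans (max_poly_roots Rj_neq0 Vroot (enum_uniq _)) (wR j).
move/leq_trans/(_ (leq_trans (leq_sub2l _ Dj) (card_undetermined DN))).
by rewrite -/V -cardE ltnn.
Qed.

End Redei.

(** * Powers and multiplicities in characteristic p *)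

Lemma deriv_eq0_pth_power (F : finFieldType) (p k : nat) (g : {poly F}) :
  prime p -> #|F| = (p ^ k)%N -> g^`() = 0 -> exists h, g = h ^+ p.
Proof.
move=> p_pr cardF g'0; have pF := card_finPcharP cardF p_pr.
have k_gt0 : (0 < k)%N.
  by case: k cardF => // cardF; have := finNzRing_gt1 F; rewrite cardF.
(* Raising to the power p^(k-1) inverts Frobenius, since c^(p^k) = c. *)
pose h := \poly_(i < size g) g`_(p * i) ^+ (p ^ k.-1).
exists h; apply/polyP => j.
have -> : h ^+ p = map_poly (pFrobenius_aut pF) h \Po 'X^p.
  elim/poly_ind: {g g'0} h => [|h c IHh].
    by rewrite rmorph0 comp_poly0 expr0n gtn_eqF ?prime_gt0.
  rewrite rmorphD rmorphM /= map_polyX map_polyC comp_polyD comp_polyM comp_polyX.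
  rewrite comp_polyC -IHh /= pFrobenius_autE polyC_exp -exprMn exprDn_pchar //.
  by rewrite (eq_pnat _ (pchar_poly _)) pnatE.
rewrite coef_comp_poly_Xn ?prime_gt0 //; case: ifP => [/dvdnP[i ->]|ndv].
  rewrite mulnK ?prime_gt0 // coef_map coef_poly /= pFrobenius_autE.
  case: ltnP => ltig; last first.
    rewrite nth_default ?expr0n ?gtn_eqF ?prime_gt0 //.
    by rewrite (leq_trans ltig) // leq_pmulr ?prime_gt0.
  by rewrite -exprM -expnSr prednK // -cardF expf_card mulnC.
have /(congr1 (fun P : {poly F} => P`_j.-1)) := g'0.
rewrite coef_deriv coef0; case: j ndv => [|j ndv /= /eqP]; first by rewrite dvdn0.
by rewrite -mulr_natr mulf_eq0 -(dvdn_pcharf pF) ndv orbF => /eqP.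
Qed.

(** Taking p-th roots divides the degree by p, so it stops; a nonconstant [g] never reaches a
    constant. *)
Lemma pth_power_root_deriv_neq0 (F : finFieldType) (p k : nat) (g : {poly F}) :
  prime p -> #|F| = (p ^ k)%N -> (1 < size g)%N ->
  exists t h, g = h ^+ (p ^ t) /\ h^`() != 0.
Proof.
move=> p_pr cardF; move: {2}(size g) (leqnn (size g)) => N.
elim: N g => [|N IHN] g; first by rewrite leqn0 => /eqP->.
move=> szg szg1; have [g'0|g'N0] := eqVneq g^`() 0; last by exists 0, g.
have [h def_g] := deriv_eq0_pth_power p_pr cardF g'0.
have szE : (size g).-1 = ((size h).-1 * p)%N by rewrite def_g size_exp.
have p1 := prime_gt1 p_pr.
have [||t [h1 [def_h h1']]] := IHN h.
- by move: szE szg szg1; move: (size g) (size h) => x y; nia.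
- by move: szE szg szg1; move: (size g) (size h) => x y; nia.
by exists t.+1, h1; rewrite def_g def_h -exprM -expnSr.
Qed.

Lemma dvdp_deriv_pth_root (F : fieldType) (p t m : nat) (h : {poly F}) (b c : F) :
  p \in [pchar F] -> h^`() != 0 -> c = h.[b] ^+ (p ^ t) ->
  ('X - b%:P) ^+ m %| h ^+ (p ^ t) - c%:P ->
  ('X - b%:P) ^+ (m.-1 %/ p ^ t) %| h^`().
Proof.
move=> pF h'N0 -> Hdvd; have p_pr := pcharf_prime pF.
have pt_gt0 : (0 < p ^ t)%N by rewrite expn_gt0 prime_gt0.
have : ('X - b%:P) ^+ m %| (h - h.[b]%:P) ^+ (p ^ t).
  suff -> : (h - h.[b]%:P) ^+ (p ^ t) = h ^+ (p ^ t) - (h.[b] ^+ (p ^ t))%:P by [].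
  apply/eqP; rewrite eq_sym subr_eq polyC_exp -exprDn_pchar ?subrK //.
  by rewrite (eq_pnat _ (pchar_poly _)) pnatX pnatE // pF.
have -> : h^`() = (h - h.[b]%:P)^`() by rewrite derivB derivC subr0.
have [j [w /implyP w_b def_h]] := multiplicity_XsubC (h - h.[b]%:P) b.
have hN0 : h - h.[b]%:P != 0.
  apply: contraNneq h'N0 => /(congr1 (@deriv F)).
  by rewrite derivB derivC subr0 deriv0 => ->.
rewrite {1}def_h exprMn -exprM => Hd.
(* The cofactor [w] does not vanish at b, so all of (x - b)^m must divide (x - b)^(j p^t). *)
have le_m : (m <= j * p ^ t)%N.
  rewrite -(@dvdp_Pexp2l _ ('X - b%:P)) ?size_XsubC //.
  move: Hd; rewrite Gauss_dvdpr // coprimep_expl // coprimep_sym coprimep_expl //.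
  by rewrite coprimep_XsubC w_b.
have : (m.-1 %/ p ^ t <= j.-1)%N.
  case: m le_m {Hd Hdvd} => [|m]; first by rewrite div0n.
  rewrite -ltn_divLR // => /=; lia.
move=> le_d; apply: dvdp_trans (dvdp_exp2l _ le_d) _.
rewrite def_h derivM deriv_exp derivXsubC mul1r.
apply: dvdp_add; first by rewrite dvdp_mull // dvdp_exp2l // leq_pred.
by rewrite dvdp_mull // -mulr_natr dvdp_mulr.
Qed.

Lemma prod_XsubC_exp_dvdp (F : fieldType) (s : seq F) (d : nat) (P : {poly F}) :
  uniq s -> {in s, forall b, ('X - b%:P) ^+ d %| P} ->
  (\prod_(b <- s) ('X - b%:P)) ^+ d %| P.
Proof.
elim: s => [|b s IHs] /=; first by rewrite big_nil expr1n dvd1p.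
case/andP=> s'b s_uniq dvdP; rewrite big_cons exprMn Gauss_dvdp.
  by rewrite dvdP ?mem_head // IHs // => c sc; rewrite dvdP // inE sc orbT.
rewrite coprimep_expl // coprimep_expr // coprimep_sym coprimep_XsubC.
by rewrite root_prod_XsubC.
Qed.

(** * Cartesian products *)

Lemma redei_setX0 (F : finFieldType) (A B : {set F}) (b : F) :
  b \in B -> ('X - b%:P) ^+ #|A| %| redei (setX A B) 0.
Proof.
move=> Bb; rewrite -prodr_const.
suff -> : redei (setX A B) 0 = \prod_(a in A) \prod_(c in B) ('X - c%:P).
  elim/big_rec2: _ => [|a P Q _ dvdPQ]; first exact: dvdpp.
  by rewrite dvdp_mul // (bigD1 b) //= dvdp_mulr.
rewrite pair_big /redei; apply: eq_big => [u | u _]; first by rewrite inE.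
by rewrite mulr0 subr0.
Qed.

(** Exchanging coordinates inverts slopes, and [flip] swaps 0 with the vertical direction. *)
Lemma directions_setX_swap_leq (F : finFieldType) (A B : {set F}) :
  (#|directions (setX B A)| <= #|directions (setX A B)|)%N.
Proof.
pose flip (d : option F) :=
  if d is Some x then if x == 0 then None else Some x^-1 else Some 0.
suff sub : directions (setX B A) \subset flip @: directions (setX A B).
  exact: leq_trans (subset_leq_card sub) (leq_imset_card _ _).
apply/subsetP => _ /imset2P[[b a] [b' a'] + + ->].
rewrite inE => /andP[/= Bb Aa]; rewrite !inE /= => /andP[/andP[Bb' Aa'] neq].
apply/imsetP; exists (direction (a, b) (a', b')).
  apply/imset2P; exists (a, b) (a', b'); rewrite ?inE /= ?Aa ?Aa' ?Bb ?Bb' //.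
  by move: neq; rewrite -!pair_eqE /pair_eq /= andbC.
move: neq; rewrite /direction /= -pair_eqE /pair_eq /=.
have [->|neq_a] := eqVneq a a'; first by rewrite andbT subrr mul0r => /negPf->.
have [->|neq_b] := eqVneq b b'; first by rewrite subrr mul0r /= eqxx.
rewrite /= mulf_eq0 invr_eq0 !subr_eq0 (eq_sym a') (eq_sym b').
by rewrite (negPf neq_a) (negPf neq_b) /= invf_div.
Qed.

Lemma card_directions_setX (F : finFieldType) (p k s : nat) (A B : {set F}) :
  prime p -> #|F| = (p ^ k)%N -> (1 < #|A|)%N -> (1 < #|B|)%N ->
  (#|A| * #|B| <= #|F|)%N ->
  (forall t, p ^ t * #|B| <= #|F| -> t <= s)%N ->
  (#|A| * #|B| < #|directions (setX A B)| + p ^ s * (#|B| - 1))%N.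
Proof.
move=> p_pr cardF A1 B1 AB_le s_max; set D := directions _.
have pF := card_finPcharP cardF p_pr; have p1 := prime_gt1 p_pr.
(* If D > q, the bound follows from mn <= q. Otherwise D <= q makes deg g < q, as [lt_hF]
   requires. *)
have [ltFD|leDF] := ltnP #|F| #|D|.
  by apply: ltn_addr; apply: leq_ltn_trans ltFD.
have /card_gt1P[a1 [a2 [Aa1 Aa2 neq_a]]] := A1.
have /card_gt1P[b1 [b2 [Bb1 Bb2 neq_b]]] := B1.
have DN : None \in D.
  apply/imset2P; exists (a1, b1) (a1, b2); rewrite ?inE /= ?Aa1 ?Bb1 ?Bb2 //=.
    by rewrite -pair_eqE /pair_eq /= eqxx.
  by rewrite /direction eqxx.
have D0 : Some 0 \in D.
  apply/imset2P; exists (a1, b1) (a2, b1); rewrite ?inE /= ?Aa1 ?Aa2 ?Bb1 //=.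
    by rewrite -pair_eqE /pair_eq /= eqxx andbT.
  by rewrite /direction /= (negPf neq_a) subrr mul0r.
have D1 : (1 < #|D|)%N by apply/card_gt1P; exists None, (Some 0).
have AB1 : (1 < #|setX A B|)%N by rewrite cardsX; move: A1 B1; nia.
have [f [g [eqX szg]]] := redei_remainder DN D1 AB1 0.
have dvd_g b : b \in B -> ('X - b%:P) ^+ #|A| %| g - b%:P.
  move=> Bb; have dvdH := dvdp_mulr f (redei_setX0 A Bb).
  (* Thus g - b = (x - b)^q - H f, and (x - b)^m divides both terms because m <= q. *)
  have XbF : ('X - b%:P) ^+ #|F| = 'X^#|F| - b%:P.
    apply/eqP; rewrite eq_sym subr_eq -{2}(expf_card b) polyC_exp.
    rewrite -exprDn_pchar ?subrK //.
    by rewrite (eq_pnat _ (pchar_poly _)) cardF pnatX pnatE // pF.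
  rewrite -(dvdp_addr _ dvdH) addrA -eqX -XbF dvdp_exp2l //.
  by apply: leq_trans AB_le; rewrite leq_pmulr // ltnW.
have g_fix b : b \in B -> g.[b] = b.
  move=> /dvd_g dvd_b; apply/eqP; rewrite -subr_eq0.
  have -> : (g.[b] - b == 0) = root (g - b%:P) b by rewrite /root !hornerE.
  by rewrite root_factor_theorem (dvdp_trans _ dvd_b) // dvdp_exp ?(ltnW A1).
have szg1 : (1 < size g)%N.
  rewrite ltnNge; apply: contraNN neq_b => /size1_polyC gC.
  by rewrite -(g_fix _ Bb1) -(g_fix _ Bb2) gC !hornerC.
have [t [h [def_g h'N0]]] := pth_power_root_deriv_neq0 p_pr cardF szg1.
have h_root b : b \in B -> h.[b] ^+ (p ^ t) = b.
  by move=> Bb; rewrite -horner_exp -def_g g_fix.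
have szgE : (size g).-1 = ((size h).-1 * p ^ t)%N by rewrite def_g size_exp.
have pt_gt0 : (0 < p ^ t)%N by rewrite expn_gt0 prime_gt0.
have lt_hF : ((size h).-1 * p ^ t < p ^ k)%N.
  by rewrite -szgE -cardF (leq_trans _ leDF) // (leq_trans _ szg) // prednK // ltnW.
have szh1 : (0 < (size h).-1)%N.
  rewrite lt0n; apply: contraTneq szg1 => h0.
  by move: szgE; rewrite h0 mul0n; case: (size g) => [|[]].
have lt_tk : (t < k)%N.
  by rewrite -(ltn_exp2l _ _ p1) (leq_ltn_trans _ lt_hF) // leq_pmull.
(* With e = p^(k-t), each b in B satisfies b^e = h(b)^q = h(b). As deg h < e, the polynomial x^e - h
   has degree e, hence |B| <= e. *)
have le_ts : (t <= s)%N.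
  apply: s_max; rewrite cardF -(subnKC (ltnW lt_tk)) expnD leq_pmul2l //.
  set e := (p ^ (k - t))%N.
  have lt_he : (size h <= e)%N.
    move: lt_hF; rewrite -(subnK (ltnW lt_tk)) expnD ltn_pmul2r // -/e.
    by case: (size h).
  have sz_e : size ('X^e - h) = e.+1 by rewrite size_polyDl ?size_polyN size_polyXn.
  rewrite cardE -ltnS -sz_e; apply: max_poly_roots (enum_uniq _).
    by rewrite -size_poly_gt0 sz_e.
  apply/allP => b; rewrite mem_enum => Bb; rewrite /root !hornerE subr_eq0.
  rewrite -{1}(h_root b Bb) -exprM -expnD subnKC 1?ltnW // -cardF.
  by rewrite expf_card.
set d := (#|A|.-1 %/ p ^ t)%N.
have dvd_h' : (\prod_(b <- enum B) ('X - b%:P)) ^+ d %| h^`().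
  apply: prod_XsubC_exp_dvdp (enum_uniq _) _ => b; rewrite mem_enum => Bb.
  apply: dvdp_deriv_pth_root pF h'N0 (esym (h_root b Bb)) _.
  by rewrite -def_g dvd_g.
have le_d : (#|B| * d < (size h).-1)%N.
  have hN0 : h != 0 by apply: contraNneq h'N0 => ->; rewrite deriv0.
  have := leq_ltn_trans (dvdp_leq h'N0 dvd_h') (lt_size_deriv hN0).
  set P := \prod_(b <- _) _; have P0 : P ^+ d != 0.
    by rewrite expf_neq0 // monic_neq0 // monic_prod_XsubC.
  rewrite -[size (P ^+ d)]prednK ?size_poly_gt0 // size_exp size_prod_XsubC -cardE.
  by case: (size h).
have lt_d : (#|A| <= d.+1 * p ^ t)%N.
  by rewrite -[X in (X <= _)%N](prednK (ltnW A1)) -ltn_divLR.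
have le_pts : (p ^ t <= p ^ s)%N by rewrite leq_exp2l.
have szgD : (((size h).-1 * p ^ t).+1 <= #|D|)%N.
  by rewrite -szgE prednK // ltnW.
(* Here D - 1 >= p^t deg h >= p^t (n d + 1) = n (d + 1) p^t - p^t (n - 1), and (d + 1) p^t >= m.
   Replacing t by s only weakens the bound. *)
move: le_d lt_d le_pts szgD B1; clear.
move: (size h).-1 (p ^ t)%N (p ^ s)%N #|A| #|B| #|D| d.
move=> x pt ps m n c d le_nd le_m le_pt le_c n1; nia.
Qed.

Theorem theorem1p7 (p k q : nat) (hp : prime p) (hq : q = (p ^ k)%N)
  (F : finFieldType) (hF : #|F| = q)
  (A B : {set F}) (m n : nat) (hA : #|A| = m) (hB : #|B| = n)
  (hm : (2 <= m)%N) (hn : (2 <= n)%N) (hmn : (m * n <= q)%N)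
  (s1 s2 : nat)
  (hs1 : (p ^ s1 * n <= q)%N)
  (hs1_max : forall t : nat, (p ^ t * n <= q)%N -> (t <= s1)%N)
  (hs2 : (p ^ s2 * m <= q)%N)
  (hs2_max : forall t : nat, (p ^ t * m <= q)%N -> (t <= s2)%N) :
  (m * n)%N%:Z - (minn (p ^ s1 * (n - 1)) (p ^ s2 * (m - 1)))%:Z + 1
    <= #|directions (setX A B)|%:Z.
Proof.
have := card_directions_setX hp (etrans hF hq) (A := A) (B := B).
rewrite hA hB hF => /(_ s1 hm hn hmn hs1_max) bound1.
have := card_directions_setX hp (etrans hF hq) (A := B) (B := A).
rewrite hA hB hF => /(_ s2 hn hm) bound2.
move: bound2; rewrite mulnC => /(_ hmn hs2_max) bound2.
(* [bound2] counts the directions of B x A, which are at most those of A x B. *)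
have le_swap := directions_setX_swap_leq A B.
move: bound1 bound2 le_swap; move: #|directions _| #|directions _| => c c'.
move: (p ^ s1 * (n - 1))%N (p ^ s2 * (m - 1))%N (m * n)%N => x y z; lia.
Qed.
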